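(* Let $\mathcal{H}$ be a real Hilbert space and $M:\mathcal{H}\to\mathcal{H}$ a monotone and continuous operator with $\mathrm{Zer}\,M\neq\emptyset$. Let $t_0\ge0$, $x_0\in\mathcal{H}$, let $\varepsilon:[t_0,+\infty)\to(0,+\infty)$ be continuously differentiable with $$\lim_{t\to+\infty}\varepsilon(t)=0\quad\text{and}\quad\int_{t_0}^{+\infty}\varepsilon(t)\,dt=+\infty,$$ and let $x:[t_0,+\infty)\to\mathcal{H}$ be the trajectory solution of $$\dot x(t)+M(x(t))+\varepsilon(t)x(t)=0,\qquad x(t_0)=x_0 .$$ Assume that, in addition, $\varepsilon$ satisfies either $$\int_{t_0}^{+\infty}|\dot\varepsilon(t)|\,dt<+\infty\qquad\text{or}\qquad \lim_{t\to+\infty}\frac{|\dot\varepsilon(t)|}{\varepsilon(t)}=0 .$$ Then $\|M(x(t))\|\to0$ as $t\to+\infty$, and therefore $x(t)$ converges strongly to the minimum norm solution $\xi_*:=P_{\mathrm{Zer}\,M}(0)$ as $t\to+\infty$.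
   Context: $M$ is monotone if $\langle M(x)-M(y),x-y\rangle\ge 0$ for all $x,y\in\mathcal{H}$. $\mathrm{Zer}\,M:=\{x\in\mathcal{H}: M(x)=0\}$, which is closed and convex; $P_{\mathrm{Zer}\,M}$ is the metric projection onto it. It is assumed that the system admits a unique strong global solution, i.e. a function $x:[t_0,+\infty)\to\mathcal{H}$ that is absolutely continuous on every compact interval $[t_0,T]$, satisfies the equation almost everywhere and the initial condition, and for which moreover $t\mapsto M(x(t))$ is absolutely continuous on every compact interval $[t_0,T]$; this is ''the trajectory solution''. *)

(* Defs.v *)
From HB Require Import structures.
From mathcomp Require Import all_boot all_order all_algebra.
From mathcomp Require Import all_classical all_reals all_analysis.

Set Implicit Arguments.
Unset Strict Implicit.
Unset Printing Implicit Defensive.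

Import Order.TTheory GRing.Theory Num.Theory.
Import numFieldNormedType.Exports.

Local Open Scope classical_set_scope.
Local Open Scope ring_scope.

(* A real Hilbert space is rendered as a complete normed module [H] with a
   positive definite symmetric bilinear form inducing its norm. *)
Definition inner_product_of_norm (R : realType) (H : completeNormedModType R)
    (ip : {dot H for idfun}) : Prop :=
  forall u : H, `|u| ^+ 2 = ip u u.

Definition monotone_operator (R : realType) (H : completeNormedModType R)
    (ip : {dot H for idfun}) (M : H -> H) : Prop :=
  forall u v : H, 0 <= ip (M u - M v) (u - v).

Definition Zer (R : realType) (H : completeNormedModType R) (M : H -> H) :
    set H :=
  [set z | M z = 0].

(* Junk value unless a nearest point exists; in a Hilbert space it exists and
   is unique whenever [C] is nonempty, closed and convex. *)
Definition metric_projection (R : realType) (H : completeNormedModType R)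
    (C : set H) (u : H) : H :=
  get [set p | C p /\ forall z, C z -> `|u - p| <= `|u - z|].

(* Epsilon-delta absolute continuity on [a, b]; the intervals are indexed by
   'I_n and may touch at endpoints. *)
Definition abs_continuous_on (R : realType) (V : normedModType R)
    (a b : R) (f : R -> V) : Prop :=
  forall e : R, 0 < e -> exists2 d : R, 0 < d &
    forall (n : nat) (l r : 'I_n -> R),
      (forall i, [/\ a <= l i, l i <= r i & r i <= b]) ->
      trivIset setT (fun i => `]l i, r i[%classic) ->
      \sum_(i < n) (r i - l i) < d ->
      \sum_(i < n) `|f (r i) - f (l i)| < e.

(* [f] is continuously differentiable on [t0, +oo[ with derivative [df], the
   derivative being taken relative to that half-line (hence one-sided at
   [t0]); values of [f] and [df] below [t0] are irrelevant. *)
Definition C1_from (R : realType) (t0 : R) (f df : R -> R) : Prop :=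
  (forall t, t0 <= t ->
     (f s - f t) / (s - t) @[s --> within (`[t0, +oo[ `\ t) (nbhs t)]
       --> df t) /\
  {within `[t0, +oo[, continuous df}.

(* Trajectories are total functions of which only the restriction to
   [t0, +oo[ matters: the excluded point [t = t0] is Lebesgue-null. *)
Definition strong_global_solution (R : realType) (H : completeNormedModType R)
    (M : H -> H) (eps : R -> R) (t0 : R) (x0 : H) (x : R -> H) : Prop :=
  [/\ forall T, t0 <= T -> abs_continuous_on t0 T x,
      forall T, t0 <= T -> abs_continuous_on t0 T (M \o x),
      {ae @lebesgue_measure R, forall t, t0 < t ->
         derivable x t 1 /\ x^`()%classic t + M (x t) + eps t *: x t = 0}
    & x t0 = x0].

Definition trajectory_solution (R : realType) (H : completeNormedModType R)
    (M : H -> H) (eps : R -> R) (t0 : R) (x0 : H) (x : R -> H) : Prop :=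
  strong_global_solution M eps t0 x0 x /\
  forall y : R -> H, strong_global_solution M eps t0 x0 y ->
    forall t, t0 <= t -> y t = x t.

(* Main.v *)
Require Import Defs.
From HB Require Import structures.
From mathcomp Require Import all_boot all_order all_algebra.
From mathcomp Require Import all_classical all_reals all_analysis.
From mathcomp Require Import ring lra.

Set Implicit Arguments.
Unset Strict Implicit.
Unset Printing Implicit Defensive.

Import Order.TTheory GRing.Theory Num.Theory.
Import numFieldNormedType.Exports.

Local Open Scope classical_set_scope.
Local Open Scope ring_scope.

(** Along the trajectory put [v t = x' t = - M (x t) - eps t * x t] and let [E]
    be a primitive of [eps], so that [E] tends to infinity.

    Regularity.  An absolutely continuous curve satisfies the mean value
    inequality for almost everywhere bounds on its derivative
    ([abs_continuous_mean_value]).  As the right-hand side of the equation is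
    continuous in time, [x] is differentiable, with derivative [v], at every
    time after [t0] ([strong_solution_is_derive]).

    Boundedness.  For a zero [xi] of [M], monotonicity gives
    [(|x - xi|^2)' <= - eps * (|x - xi|^2 - |xi|^2)], and the Gronwall inequality
    bounds [x] ([trajectory_bounded]).

    Vanishing speed.  Let [D h t = (x (t + h) - x t) / h].  By monotonicity, the
    derivative of [|D h|^2] at [t] is at most
    [- 2 * eps (t + h) * |D h t|^2 - 2 * q * <x t, D h t>], where [q] is the
    difference quotient of [eps]; neither [M] nor [v] is differentiated.
    Let [B] bound both [1] and [|x|^2].  Gronwall and [h -> 0] give, for
    [s <= t]: if [|eps'|] has a bounded primitive
    [V], then
    [1 + |v t|^2 <= exp (B * (sup V - V s)) * (1 + exp (2 * (E s - E t)) * |v s|^2)]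
    ([speed_bound_integrable]); if [|eps'| <= d * eps] after [s], then
    [|v t|^2 <= d^2 * B + exp (E s - E t) * |v s|^2] ([speed_bound_ratio]).
    Letting [t] and then [s] tend to infinity yields [v t -> 0], so
    [M (x t) = - v t - eps t * x t] tends to [0].

    Strong convergence.  Let [p] be the zero of [M] of least norm.  Bounded
    points [u] with [M u] small satisfy [<p, u - p> >= - d], for any given
    [d > 0] ([min_norm_zero]).  The usual weak compactness argument is replaced
    by nested closed convex sets, defined by the inequalities
    [<M z, z - u> >= - r], that contain these points and, by Minty's lemma,
    intersect in [Zer M] ([nested_convex_min_norm]).  Since [M (x t) -> 0],
    eventually [(|x - p|^2)' <= - 2 * eps * (|x - p|^2 - d)], and a last use of
    Gronwall gives [x t -> p] ([trajectory_cvg]). *)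

(** * Inner products *)

Section InnerProduct.
Context {R : realType} {H : completeNormedModType R} {ip : {dot H for idfun}}.

Lemma ipC u v : ip u v = ip v u.
Proof. by rewrite hermC /= expr0 mul1r. Qed.

Lemma ipDl u v w : ip (u + v) w = ip u w + ip v w.
Proof. by rewrite linearDl. Qed.

Lemma ipDr u v w : ip w (u + v) = ip w u + ip w v.
Proof. by rewrite linearD. Qed.

Lemma ipNl u w : ip (- u) w = - ip u w.
Proof. by rewrite linearNl. Qed.

Lemma ipNr u w : ip w (- u) = - ip w u.
Proof. by rewrite linearN. Qed.

Lemma ipZl a v w : ip (a *: v) w = a * ip v w.
Proof. by rewrite linearZl_LR. Qed.

Lemma ipZr a v w : ip w (a *: v) = a * ip w v.
Proof. by rewrite linearZ. Qed.

Hypothesis ip_norm : inner_product_of_norm ip.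

Lemma ip_ge0 u : 0 <= ip u u.
Proof. by rewrite -ip_norm sqr_ge0. Qed.

(** The Cauchy-Schwarz inequality. *)
Lemma ler_norm_ip u v : `|ip u v| <= `|u| * `|v|.
Proof.
have key : `|u| ^+ 2 * ip u v ^+ 2 <= `|u| ^+ 2 * (`|u| ^+ 2 * `|v| ^+ 2).
  have := ip_ge0 (ip u u *: v - ip u v *: u).
  rewrite !(ipDl, ipDr, ipNl, ipNr, ipZl, ipZr) (ipC v u) !ip_norm.
  nra.
have [->|u0] := eqVneq u 0; first by rewrite linear0l !normr0 mul0r.
have u20 : 0 < `|u| ^+ 2 by rewrite exprn_gt0 // normr_gt0.
rewrite -(@ler_pXn2r _ 2) ?nnegrE ?mulr_ge0 //.
by rewrite real_normK ?num_real // exprMn -(ler_pM2l u20).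
Qed.

(** Polarization expresses the inner product by norms, whence its continuity. *)
Lemma cvg_ip {T : Type} (F : set_system T) {FF : Filter F} (f g : T -> H)
    (a b : H) :
  f @ F --> a -> g @ F --> b -> ip (f t) (g t) @[t --> F] --> ip a b.
Proof.
move=> fa gb.
have polar u v : ip u v = 4^-1 * (`|u + v| ^+ 2 - `|u - v| ^+ 2).
  by rewrite !ip_norm !(ipDl, ipDr, ipNl, ipNr) (ipC v u); field.
rewrite polar; under eq_cvg do rewrite polar.
have sq (h : T -> H) l : h @ F --> l -> `|h t| ^+ 2 @[t --> F] --> `|l| ^+ 2.
  by move=> hl; rewrite expr2; under eq_cvg do rewrite expr2; apply: cvgM; exact: cvg_norm.
apply: cvgMl_tmp; apply: cvgB; apply: sq; [exact: cvgD | exact: cvgB].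
Qed.

Lemma is_derive_ip (f : R -> H) (t : R) (df c : H) :
  is_derive t 1 f df ->
  is_derive t 1 (fun s => ip (f s - c) (f s - c)) (2 * ip df (f t - c)).
Proof.
move=> [fdrv fdf].
have quot : h^-1 *: (f (h *: 1 + t) - f t) @[h --> 0^'] --> df.
  by rewrite -fdf; exact: fdrv.
have fcont : f (h *: 1 + t) @[h --> 0^'] --> f t.
  have fc : {for t, continuous f} by apply/differentiable_continuous/derivable1_diffP.
  apply: cvg_within_filter.
  have shift : h *: 1 + t @[h --> (0 : R)] --> t.
    have -> : nbhs t = nbhs ((0 : R) *: 1 + t) by rewrite scale0r add0r.
    by apply: cvgD; [apply: cvgZr_tmp; exact: cvg_id | exact: cvg_cst].
  exact: cvg_comp shift fc.
have lim : h^-1 *: (ip (f (h *: 1 + t) - c) (f (h *: 1 + t) - c) -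
    ip (f t - c) (f t - c)) @[h --> 0^'] --> 2 * ip df (f t - c).
  have -> : 2 * ip df (f t - c) = ip df (f t - c + (f t - c)).
    by rewrite !(ipDl, ipDr, ipNl, ipNr); ring.
  have -> : (fun h => h^-1 *: (ip (f (h *: 1 + t) - c) (f (h *: 1 + t) - c) -
      ip (f t - c) (f t - c))) = (fun h => ip (h^-1 *: (f (h *: 1 + t) - f t))
      (f (h *: 1 + t) - c + (f t - c))).
    apply/funext => h; rewrite ipZl /GRing.scale /=; congr (_ * _).
    rewrite !(ipDl, ipDr, ipNl, ipNr) !(ipC _ c) (ipC (f t) (f (_ + t))).
    by ring.
  apply: cvg_ip => //; apply: cvgD; last exact: cvg_cst.
  by apply: cvgB => //; exact: cvg_cst.
apply: DeriveDef; first by apply/cvg_ex; eexists; exact: lim.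
exact: (cvg_lim _ lim).
Qed.

End InnerProduct.

(** * Absolutely continuous functions with bounded derivative *)

(** Differentiability as a first-order approximation, without division. *)
Lemma is_deriveP {R : realType} {V : normedModType R} (f : R -> V) (t : R)
    (df : V) :
  is_derive t 1 f df <->
  forall e : R, 0 < e -> exists2 d : R, 0 < d & forall s, `|s - t| < d ->
    `|f s - f t - (s - t) *: df| <= e * `|s - t|.
Proof.
split=> [[fdrv fdf] e e0|approx].
  have : h^-1 *: (f (h *: 1 + t) - f t) @[h --> 0^'] --> df.
    by rewrite -fdf; exact: fdrv.
  move=> /cvgrPdist_le /(_ _ e0); rewrite near_withinE => /nbhs_ballP[d /= d0 near0].
  exists d => // s std; have [->|st] := eqVneq s t.
    by rewrite !subrr scale0r subr0 !normr0 mulr0.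
  have st0 : s - t != 0 by rewrite subr_eq0.
  have /near0 /(_ st0) : ball (0 : R) d (s - t) by rewrite /ball /= sub0r normrN.
  rewrite /= (mulr1 (s - t) : (s - t) *: 1 = s - t) subrK => bound.
  have -> : f s - f t - (s - t) *: df = (s - t) *: ((s - t)^-1 *: (f s - f t) - df).
    by rewrite scalerBr scalerA divff // scale1r.
  by rewrite normrZ mulrC ler_wpM2r // distrC.
have lim : h^-1 *: (f (h *: 1 + t) - f t) @[h --> 0^'] --> df.
  apply/cvgrPdist_le => e /approx[d d0 near_t].
  rewrite near_withinE; apply/nbhs_ballP; exists d => // h hd h0 /=.
  rewrite /ball /= sub0r normrN in hd.
  have := near_t (h *: 1 + t); rewrite addrK (mulr1 h : h *: 1 = h) => /(_ hd) bound.
  have hpos : 0 < `|h| by rewrite normr_gt0.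
  rewrite -(ler_pM2r hpos) [X in X <= _]mulrC -normrZ scalerBr scalerA divff // scale1r distrC.
  exact: bound.
apply: DeriveDef; first by apply/cvg_ex; eexists; exact: lim.
exact: (cvg_lim _ lim).
Qed.

(** Induction along a segment: by completeness of the reals, a property that passes from the
    left of every point to its right reaches the other end. *)
Lemma segment_induction {R : realType} (P : R -> Prop) (a b : R) :
  a <= b -> P a ->
  (forall c, a <= c <= b -> exists2 d : R, 0 < d & forall u v,
     a <= u <= c -> c <= v <= b -> c - d < u -> v < c + d -> P u -> P v) ->
  P b.
Proof.
move=> ab Pa step; pose S := [set s | a <= s <= b /\ P s].
have Sa : S a by split=> //; rewrite lexx.
have ubS : ubound S b by move=> s [/andP[_ sb] _].
have supS : has_sup S by split; [exists a | exists b].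
have cS s : S s -> s <= sup S by move=> Ss; exact: (sup_upper_bound supS).
have acb : a <= sup S <= b.
  by rewrite cS //=; apply: ge_sup => //; exists a.
have [d d0 stepc] := step _ acb.
have [u Su ud] := sup_adherent d0 supS.
have [/andP[au ub] Pu] := Su.
have d20 : 0 < d / 2 by rewrite divr_gt0.
have [bc|cb] := leP b (sup S + d / 2).
  apply: (stepc u b) => //; first by rewrite au cS.
  - by case/andP: acb => _ ->; rewrite lexx.
  - by apply: le_lt_trans bc _; lra.
have Pv : P (sup S + d / 2).
  apply: (stepc u) => //; first by rewrite au cS.
  - by rewrite (ltW cb) andbT; lra.
  - by lra.
have Sv : S (sup S + d / 2) by split=> //; rewrite (ltW cb) andbT; lra.
by have := cS _ Sv; lra.
Qed.

(** [interval_chain U a s L] says that [L] lists, from right to left, the pairs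
    of endpoints of finitely many nonoverlapping intervals between [a] and [s]
    whose interiors lie in [U]. *)
Fixpoint interval_chain {R : realType} (U : set R) (a s : R) (L : seq (R * R)) : Prop :=
  if L is p :: L' then
    [/\ a <= p.1, p.1 <= p.2, p.2 <= s, `]p.1, p.2[ `<=` U & interval_chain U a p.1 L']
  else True.

Section IntervalChain.
Context {R : realType} (U : set R) (a : R).
Implicit Types (s : R) (L : seq (R * R)).

Lemma interval_chain_widen s s' L :
  s <= s' -> interval_chain U a s L -> interval_chain U a s' L.
Proof. by case: L => //= p L ss' [? ? ps ? ?]; split=> //; exact: le_trans ps ss'. Qed.

Lemma interval_chain_bounds s L i : interval_chain U a s L -> (i < size L)%N ->
  let p := nth (0, 0) L i in [/\ a <= p.1, p.1 <= p.2 & p.2 <= s].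
Proof.
elim: L s i => //= p L IH s [|i] [ap pp ps pU ch]; first by split.
by rewrite ltnS => /(IH _ _ ch)[? ? qp]; split=> //; apply: le_trans qp (le_trans pp ps).
Qed.

Lemma interval_chain_ordered s L i j : interval_chain U a s L ->
  (i < j < size L)%N -> (nth (0, 0) L j).2 <= (nth (0, 0) L i).1.
Proof.
elim: L s i j => [|p L IH] s [|i] [|j] //=; rewrite ?andbF // => -[ap pp ps pU ch].
  by rewrite ltnS /= => /(interval_chain_bounds ch)[].
by rewrite !ltnS; exact: IH ch.
Qed.

Lemma interval_chain_length s L : open U -> interval_chain U a s L ->
  ((\sum_(p <- L) (p.2 - p.1))%:E <= lebesgue_measure (U `&` `]-oo, s[))%E.
Proof.
move=> oU; have mU : measurable U by exact: measurable_realfun.open_measurable.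
have mUI (r : R) : measurable (U `&` `]-oo, r[) by exact: measurableI.
elim: L s => [|p L IH] s /=; first by rewrite big_nil.
move=> [ap pp ps pU ch]; rewrite big_cons EFinD.
have -> : (p.2 - p.1)%:E = lebesgue_measure `]p.1, p.2[.
  rewrite lebesgue_measure_itv /= lte_fin; case: ltgtP pp => //.
  by move=> -> _; rewrite subrr.
apply: le_trans (leeD2l _ (IH _ ch)) _.
have disj : `]p.1, p.2[ `&` (U `&` `]-oo, p.1[) = set0.
  rewrite -subset0 => r [] /=; rewrite !in_itv /= => /andP[pr _] [_ rp].
  by move: (lt_trans pr rp); rewrite ltxx.
rewrite -measureU //; last exact: mUI.
apply: le_measure; rewrite ?inE //.
- apply: measurableU => //; exact: mUI.
- exact: mUI.
move=> r [rp|[Ur]]; rewrite /= !in_itv /=.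
  split; first exact: pU.
  by move: rp; rewrite /= in_itv /= => /andP[_ /lt_le_trans]; apply.
by move=> rp; split=> //; apply: lt_le_trans rp (le_trans pp ps).
Qed.

Lemma interval_chain_abs_continuous {V : normedModType R} (b d e : R)
    (f : R -> V) s L :
  (forall (n : nat) (l r : 'I_n -> R),
      (forall i, [/\ a <= l i, l i <= r i & r i <= b]) ->
      trivIset setT (fun i => `]l i, r i[%classic) ->
      \sum_(i < n) (r i - l i) < d ->
      \sum_(i < n) `|f (r i) - f (l i)| < e) ->
  s <= b -> interval_chain U a s L -> \sum_(p <- L) (p.2 - p.1) < d ->
  \sum_(p <- L) `|f p.2 - f p.1| < e.
Proof.
move=> ac sb ch; rewrite !(big_nth (0, 0)) !big_mkord.
apply: (ac _ (fun i => (nth (0, 0) L i).1) (fun i => (nth (0, 0) L i).2)).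
  move=> i; have [? ? ps] := interval_chain_bounds ch (ltn_ord i).
  by split=> //; exact: le_trans ps sb.
have disj (i j : 'I_(size L)) (r : R) : (i < j)%N ->
    `](nth (0, 0) L i).1, (nth (0, 0) L i).2[%classic r ->
    `](nth (0, 0) L j).1, (nth (0, 0) L j).2[%classic r -> False.
  move=> ij; rewrite /= !in_itv /= => /andP[ir _] /andP[_ rj].
  have := @interval_chain_ordered _ _ i j ch; rewrite ij ltn_ord => /(_ isT) ji.
  by have := lt_trans ir rj; rewrite ltNge ji.
move=> i j _ _ [r [ri rj]]; apply/val_inj.
by case: (ltngtP i j) => // [ij|ji]; [case: (disj i j r) | case: (disj j i r)].
Qed.

End IntervalChain.

(** Mean value inequality for absolutely continuous functions.  Off a null set
    the increments are controlled by the derivative; on an open neighbourhood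
    of the null set, of small measure, by absolute continuity. *)
Lemma abs_continuous_mean_value {R : realType} {V : normedModType R} (a b K : R)
    (c : V) (f : R -> V) :
  a <= b -> 0 <= K -> abs_continuous_on a b f ->
  {ae @lebesgue_measure R, forall t, a < t < b ->
     derivable f t 1 /\ `|f^`()%classic t - c| <= K} ->
  `|f b - f a - (b - a) *: c| <= K * (b - a).
Proof.
move=> ab K0 ac ae.
apply/ler_addgt0Pr => e e0.
pose e' := e / (b - a + 1 + `|c|).
have den0 : 0 < b - a + 1 + `|c|.
  by rewrite ltr_wpDr // addrC ltr_wpDr // subr_ge0.
have e'0 : 0 < e' by rewrite divr_gt0.
have [d d0 acd] := ac _ e'0.
have null1 (r : R) : lebesgue_measure.-negligible [set r].
  by exists [set r]; split=> //; exact: lebesgue_measure_set1.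
(* The endpoints [a] and [b] join the null set: nothing is assumed there. *)
have [B [mB B0 badB]] := negligibleU ae (negligibleU (null1 a) (null1 b)).
pose m := Num.min d e'.
have m0 : 0 < m by rewrite lt_min d0.
have Bfin : (lebesgue_measure B < +oo)%E by rewrite B0.
have [U [oU BU Um]] := lebesgue_regularity_outer mB Bfin m0.
have mU : measurable U by exact: measurable_realfun.open_measurable.
have U_lt : (lebesgue_measure U < m%:E)%E.
  apply: le_lt_trans Um; rewrite -[leRHS]adde0 -B0.
  apply: le_trans (measureU2 _ _ _) => //; last exact: measurableD.
  apply: le_measure; rewrite ?inE //; first by apply: measurableU => //; exact: measurableD.
  by move=> r Ur; have [Br|nBr] := pselect (B r); [right | left].
(* [P s] bounds the increment of [g] over [a, s] up to a chain of intervals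
   inside [U], whose contribution is kept aside; it passes over a null point by
   adding one interval to the chain, over any other point by differentiability. *)
pose g s := f s - s *: c.
have gB u v : g v - g u = f v - f u - (v - u) *: c.
  by rewrite /g opprD addrACA -opprD -scalerBl.
pose h (p : R * R) := `|f p.2 - f p.1| + `|c| * (p.2 - p.1).
pose P s := exists2 L, interval_chain U a s L &
  `|g s - g a| <= (K + e') * (s - a) + \sum_(p <- L) h p.
have [L chL bound] : P b.
  apply: (segment_induction ab).
    by exists [::] => //; rewrite big_nil !subrr normr0 mulr0 addr0.
  move=> s /andP[as_ sb].
  have [sB|sB] := pselect (B s).
    have /nbhs_ballP[r /= r0 rU] : nbhs s U by apply: oU; exact: BU.
    exists r => // u v /andP[au us] /andP[sv vb] ru vr [L chL boundu].
    have uv := le_trans us sv.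
    exists ((u, v) :: L).
      split=> //= w; rewrite /= in_itv /= => /andP[uw wv].
      by apply: rU; rewrite /ball /= ltr_distlC; apply/andP; split; lra.
    rewrite big_cons {1}/h /=.
    have -> : g v - g a = (f v - f u) - (v - u) *: c + (g u - g a).
      by rewrite -gB subrKA.
    apply: le_trans (ler_normD _ _) _.
    have := ler_normB (f v - f u) ((v - u) *: c).
    rewrite normrZ (ger0_norm (_ : 0 <= v - u)) ?subr_ge0 //.
    have : (K + e') * (u - a) <= (K + e') * (v - a).
      by rewrite ler_wpM2l ?lerD2r // addr_ge0 // ltW.
    by lra.
  have [asb [fs Ks]] : a < s < b /\ derivable f s 1 /\ `|f^`()%classic s - c| <= K.
    have asb : a < s < b.
      rewrite !lt_neqAle as_ sb !andbT; apply/andP; split; apply/negP => /eqP sE; apply/sB/badB.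
        by right; left.
      by right; right.
    split=> //; apply: contrapT => bad; apply/sB/badB; left => /= good.
    exact: bad (good asb).
  have /is_deriveP/(_ _ e'0)[r r0 near_s] : is_derive s 1 f (f^`()%classic s).
    by apply: DeriveDef => //; rewrite derive1E.
  have gs w : `|w - s| < r -> `|g w - g s| <= (K + e') * `|w - s|.
    move=> /near_s bnd.
    have -> : g w - g s = (f w - f s - (w - s) *: f^`()%classic s) +
       (w - s) *: (f^`()%classic s - c).
      by rewrite gB scalerBr subrKA.
    rewrite mulrDl addrC; apply: le_trans (ler_normD _ _) _; apply: lerD => //.
    by rewrite normrZ mulrC ler_wpM2r.
  exists r => // u v /andP[au us] /andP[sv vb] ru vr [L chL boundu].
  exists L; first exact: interval_chain_widen (le_trans us sv) chL.
  have := @gs u; rewrite distrC (ger0_norm (_ : 0 <= s - u)) ?subr_ge0 // => gsu.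
  have := @gs v; rewrite (ger0_norm (_ : 0 <= v - s)) ?subr_ge0 // => gsv.
  have {}gsu : `|g u - g s| <= (K + e') * (s - u) by apply: gsu; lra.
  have {}gsv : `|g v - g s| <= (K + e') * (v - s) by apply: gsv; lra.
  have -> : g v - g a = (g v - g s) - (g u - g s) + (g u - g a).
    by rewrite [- (g u - g s)]opprB !subrKA.
  apply: le_trans (ler_normD _ _) _.
  have := ler_normB (g v - g s) (g u - g s).
  by lra.
have : ((\sum_(p <- L) (p.2 - p.1))%:E < m%:E)%E.
  apply: le_lt_trans (interval_chain_length oU chL) _.
  apply: le_lt_trans U_lt; apply: le_measure; rewrite ?inE //; exact: measurableI.
rewrite lte_fin lt_min => /andP[Ld Le].
have fL := interval_chain_abs_continuous acd (lexx b) chL Ld.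
have -> : f b - f a - (b - a) *: c = g b - g a by rewrite gB.
apply: le_trans bound _; rewrite /h big_split /= -mulr_sumr.
have cL : `|c| * \sum_(p <- L) (p.2 - p.1) <= `|c| * e' by rewrite ler_wpM2l // ltW.
have <- : e' * (b - a + 1 + `|c|) = e by rewrite /e' divfK // gt_eqF.
by lra.
Qed.

Lemma abs_continuous_on_sub {R : realType} {V : normedModType R}
    (a b a' b' : R) (f : R -> V) :
  a <= a' -> b' <= b -> abs_continuous_on a b f -> abs_continuous_on a' b' f.
Proof.
move=> aa bb ac e /ac[d d0 acd]; exists d => // n l r lr; apply: acd => i.
by have [al ? rb] := lr i; split=> //; [exact: le_trans aa al | exact: le_trans rb bb].
Qed.

Lemma abs_continuous_continuous {R : realType} {V : normedModType R}
    (a b t : R) (f : R -> V) :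
  abs_continuous_on a b f -> a < t < b -> {for t, continuous f}.
Proof.
move=> ac /andP[at_ tb]; apply/cvgrPdist_lt => e /ac[d d0 acd].
have one (u v : R) : a <= u -> u <= v -> v <= b -> v - u < d -> `|f v - f u| < e.
  move=> au uv vb uvd; have := acd 1 (fun _ => u) (fun _ => v).
  rewrite !big_ord1; apply => //.
  by move=> i j _ _ _; rewrite !ord1.
apply/nbhs_ballP; exists (Num.min d (Num.min (t - a) (b - t))) => /=.
  by rewrite !lt_min d0 !subr_gt0 at_ tb.
move=> s; rewrite /ball /= !lt_min => /and3P[std sta stb].
have [st|ts] := leP s t.
- rewrite ger0_norm ?subr_ge0 // in std sta stb.
  by apply: one => //; lra.
- rewrite distrC gtr0_norm ?subr_gt0 // in std sta stb.
  by rewrite distrC; apply: one => //; lra.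
Qed.

(** A locally absolutely continuous function whose derivative agrees almost
    everywhere with [g] is differentiable wherever [g] is continuous. *)
Lemma ae_derive_continuous {R : realType} {V : normedModType R} (t0 t : R)
    (f g : R -> V) :
  (forall T, t0 <= T -> abs_continuous_on t0 T f) ->
  {ae @lebesgue_measure R, forall s, t0 < s ->
     derivable f s 1 /\ f^`()%classic s = g s} ->
  t0 < t -> {for t, continuous g} -> is_derive t 1 f (g t).
Proof.
move=> ac ae t0t gt; apply/is_deriveP => e e0.
have /cvgrPdist_le/(_ _ e0)/nbhs_ballP[d /= d0 gd] := gt.
exists (Num.min d (t - t0)); first by rewrite lt_min d0 subr_gt0.
have bound (u v : R) : t0 < u -> u <= v ->
    (forall s, u < s < v -> `|t - s| < d) ->
    `|f v - f u - (v - u) *: g t| <= e * (v - u).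
  move=> t0u uv near_t; apply: abs_continuous_mean_value => //; first exact: ltW.
    by apply: abs_continuous_on_sub (ltW t0u) (lexx v) (ac _ _); exact: le_trans (ltW t0u) uv.
  apply: negligibleS ae => s /= bad good; apply: bad => usv; have /andP[us _] := usv.
  have [drv ->] := good (lt_trans t0u us); split=> //.
  by rewrite distrC; apply: gd; exact: near_t.
move=> s; rewrite lt_min => /andP[std stt].
have [st|ts] := leP s t.
- rewrite distrC ger0_norm ?subr_ge0 // in std stt.
  have -> : f s - f t - (s - t) *: g t = - (f t - f s - (t - s) *: g t).
    by rewrite opprD opprK opprB -(opprB t s) scaleNr opprK.
  rewrite normrN (distrC s t) (ger0_norm (_ : 0 <= t - s)) ?subr_ge0 //.
  by apply: bound => //; [lra | move=> w /andP[sw wt]; rewrite ger0_norm; lra].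
- rewrite (gtr0_norm (_ : 0 < s - t)) ?subr_gt0 // in std stt *.
  by apply: bound; [lra | lra | move=> w /andP[tw ws]; rewrite distrC gtr0_norm; lra].
Qed.

(** * Real functions on a half-line *)

Section HalfLine.
Context {R : realType}.
Implicit Types (f F e E u : R -> R) (a : R).

(** The primitive is built from the extension of [f] that is constant to the
    left of [a], so that it is differentiable at [a] as well. *)
Lemma exists_primitive f a : {within `[a, +oo[, continuous f} ->
  exists F, forall t, a <= t -> is_derive t 1 F (f t).
Proof.
move=> /subspace_continuousP fc.
pose fe s := f (Num.max s a).
have fec : continuous fe.
  move=> t; apply/cvgrPdist_lt => e e0.
  have /fc/cvgrPdist_lt/(_ _ e0) : `[a, +oo[%classic (Num.max t a).
    by rewrite /= in_itv /= andbT le_max lexx orbT.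
  rewrite near_withinE => /nbhs_ballP[d /= d0 near_t].
  apply/nbhs_ballP; exists d => // s; rewrite /ball /= => std.
  apply: near_t => /=; last by rewrite in_itv /= andbT le_max lexx orbT.
  rewrite /ball /=; apply: le_lt_trans std.
  have := ler_norm (t - s); have := ler_norm (s - t); rewrite (distrC s t).
  by rewrite ler_norml; case: (leP t a) => ?; case: (leP s a) => ?; lra.
exists (fun x => \int[lebesgue_measure]_(t in `[a - 1, x]) fe t) => t at_.
have [] := @continuous_FTC1_closed _ fe (a - 1) t (t + 1).
- by rewrite ltrDl.
- apply: continuous_compact_integrable; first exact: segment_compact.
  exact: continuous_subspaceT.
- by lra.
- exact: fec.
move=> drv val; apply: DeriveDef => //.
by rewrite -derive1E val /fe max_l.
Qed.

Lemma nonincreasing_of_derive f (df : R -> R) a :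
  (forall t, a <= t -> is_derive t 1 f (df t)) ->
  (forall t, a <= t -> df t <= 0) ->
  forall s t, a <= s -> s <= t -> f t <= f s.
Proof.
move=> fdf df0 s t as_ st.
have [||c + ftsE] := @MVT_segment _ f df s t st.
- by move=> c; rewrite in_itv /= => /andP[sc _]; apply: fdf; exact: le_trans as_ (ltW sc).
- apply: derivable_within_continuous => c; rewrite in_itv /= => /andP[sc _].
  by have [] := fdf c (le_trans as_ sc).
rewrite in_itv /= => /andP[sc ct]; rewrite -subr_le0 ftsE.
by rewrite mulr_le0_ge0 ?subr_ge0 //; apply: df0; exact: le_trans as_ sc.
Qed.

Lemma nondecreasing_of_derive f (df : R -> R) a :
  (forall t, a <= t -> is_derive t 1 f (df t)) ->
  (forall t, a <= t -> 0 <= df t) ->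
  forall s t, a <= s -> s <= t -> f s <= f t.
Proof.
move=> fdf df0 s t as_ st; rewrite -lerN2.
apply: (@nonincreasing_of_derive (fun x => - f x) (fun x => - df x) a) => //.
- by move=> r ar; have := fdf r ar => ?; exact: is_deriveN.
- by move=> r ar; rewrite oppr_le0 df0.
Qed.

(** Gronwall inequality: where [u' <= - e * (u - K)] with [E' = e], the product
    [(u - K) * exp E] is nonincreasing. *)
Lemma gronwall u (du : R -> R) E e (K a : R) :
  (forall t, a <= t -> is_derive t 1 u (du t)) ->
  (forall t, a <= t -> is_derive t 1 E (e t)) ->
  (forall t, a <= t -> du t <= - e t * (u t - K)) ->
  forall s t, a <= s -> s <= t -> u t - K <= expR (E s - E t) * (u s - K).
Proof.
move=> udu Ee ineq s t as_ st.
have mono : (u t - K) * expR (E t) <= (u s - K) * expR (E s).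
  apply: (@nonincreasing_of_derive (fun r => (u r - K) * expR (E r))
    (fun r => expR (E r) * (du r + e r * (u r - K))) a) => // r ar.
    have ur := udu r ar; have Er := Ee r ar.
    apply: is_derive_eq.
    rewrite /GRing.scale /=. ring.
  have := ineq r ar => ineqr.
  by rewrite mulr_ge0_le0 ?expR_ge0 //; lra.
rewrite expRD mulrAC -(ler_pM2r (expR_gt0 (E t))) [leRHS]mulrAC.
by rewrite -mulrA expRxMexpNx_1 // mulr1 [leRHS]mulrC.
Qed.

(** A nonnegative function with finite integral has bounded primitives. *)
Lemma primitive_bounded f F a :
  {within `[a, +oo[, continuous f} -> (forall t, a <= t -> 0 <= f t) ->
  (forall t, a <= t -> is_derive t 1 F (f t)) ->
  (\int[lebesgue_measure]_(t in `[a, +oo[) (f t)%:E < +oo)%E ->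
  exists K, forall t, a <= t -> F t <= K.
Proof.
move=> fc f0 Ff int.
exists (F a + fine (\int[lebesgue_measure]_(t in `[a, +oo[) (f t)%:E)%E) => t.
rewrite le_eqVlt => /predU1P[<-|at_].
  rewrite lerDl fine_ge0 //; apply: integral_ge0 => s /=; rewrite in_itv /= andbT => as_.
  by rewrite lee_fin f0.
have drv s : a <= s -> derivable F s 1 by move=> /Ff [].
have cts s : a <= s -> {for s, continuous F}.
  by move=> as_; apply/differentiable_continuous/derivable1_diffP/drv.
have mf : measurable_fun `[a, +oo[ f.
  exact: measurable_realfun.subspace_continuous_measurable_fun.
have int0 : (0 <= \int[lebesgue_measure]_(t in `[a, +oo[) (f t)%:E)%E.
  by apply: integral_ge0 => s /=; rewrite in_itv /= andbT lee_fin => /f0.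
rewrite addrC -lerBlDr -lee_fin fineK; last by rewrite ge0_fin_numE.
rewrite EFinB -(@continuous_FTC2 _ f) //.
- apply: ge0_subset_integral => //.
  + exact/measurable_realfun.measurable_EFinP.
  + by move=> s /=; rewrite in_itv /= andbT lee_fin => /f0.
  + by move=> s /=; rewrite !in_itv /= => /andP[->].
- apply: continuous_subspaceW fc => s /=.
  by rewrite !in_itv /= => /andP[->].
- split.
  + by move=> s; rewrite in_itv /= => /andP[as_ _]; apply: drv; exact: ltW.
  + exact/cvg_at_right_filter/cts.
  + exact/cvg_at_left_filter/cts/ltW.
- move=> s; rewrite in_itv /= => /andP[as_ _].
  by have [_ <-] := Ff s (ltW as_); rewrite derive1E.
Qed.

(** A nonnegative function with infinite integral has primitives tending to
    infinity. *)
Lemma primitive_unbounded f F a :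
  {within `[a, +oo[, continuous f} -> (forall t, a <= t -> 0 <= f t) ->
  (forall t, a <= t -> is_derive t 1 F (f t)) ->
  (\int[lebesgue_measure]_(t in `[a, +oo[) (f t)%:E = +oo)%E ->
  F t @[t --> +oo] --> +oo.
Proof.
move=> fc f0 Ff int.
have mono := nondecreasing_of_derive Ff f0.
apply/cvgryPge => A; apply: contrapT => bounded.
(* A bounded primitive would converge, and the integral would be finite. *)
have FA t : a <= t -> F t <= A.
  move=> at_; rewrite leNgt; apply/negP => AF; apply: bounded.
  apply: filterS (nbhs_pinfty_ge (num_real t)) => s ts.
  by apply: (le_trans (ltW AF)); exact: mono.
pose Fa t := F (Num.max t a).
have Fa_mono : nondecreasing_fun Fa.
  move=> s t st; apply: mono; first by rewrite le_max lexx orbT.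
  by rewrite ge_max !le_max st lexx /= orbT.
have Fa_cvg : Fa t @[t --> +oo] --> sup (range Fa).
  apply: nondecreasing_cvgr => //; exists A => _ [t _ <-].
  by apply: FA; rewrite le_max lexx orbT.
have F_cvg : F t @[t --> +oo] --> sup (range Fa).
  apply: cvg_trans Fa_cvg; apply: near_eq_cvg.
  by apply: filterS (nbhs_pinfty_ge (num_real a)) => t at_; rewrite /Fa max_l.
have drv s : a <= s -> derivable F s 1 by move=> /Ff [].
have := @ge0_continuous_FTC2y _ f F a _ f0 fc F_cvg.
rewrite int => absurd; suff : (+oo = (sup (range Fa))%:E - (F a)%:E :> \bar R)%E by [].
apply: absurd.
- by move=> s as_; apply: drv; exact: ltW.
- apply: cvg_at_right_filter; apply/differentiable_continuous/derivable1_diffP/drv.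
  exact: lexx.
- move=> s; rewrite in_itv /= andbT => as_.
  by have [_ <-] := Ff s (ltW as_); rewrite derive1E.
Qed.

End HalfLine.

(** * The minimum norm zero *)

Section MinimumNorm.
Context {R : realType} {H : completeNormedModType R} {ip : {dot H for idfun}}.
Hypothesis ip_norm : inner_product_of_norm ip.

Lemma sqr_normD (u v : H) : `|u + v| ^+ 2 = `|u| ^+ 2 + 2 * ip u v + `|v| ^+ 2.
Proof. by rewrite !ip_norm !(ipDl, ipDr) (ipC v u); ring. Qed.

Lemma sqr_normB (u v : H) : `|u - v| ^+ 2 = `|u| ^+ 2 - 2 * ip u v + `|v| ^+ 2.
Proof. by rewrite sqr_normD ipNr normrN; ring. Qed.

(** For nested closed convex sets with a common point, nearly norm-minimal
    points of the successive sets converge to the point of least norm of the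
    intersection.  The last clause, a variational inequality that already holds
    on one of the sets up to [d], stands in for weak compactness. *)
Lemma nested_convex_min_norm (C : nat -> set H) (q : H) :
  (forall n, closed (C n)) ->
  (forall n u v s, C n u -> C n v -> 0 <= s <= 1 -> C n (u + s *: (v - u))) ->
  (forall n m, (n <= m)%N -> C m `<=` C n) ->
  (forall n, C n q) ->
  exists p, [/\ forall n, C n p,
    forall z, (forall n, C n z) -> `|p| <= `|z| &
    forall B d : R, 0 < d -> exists n, forall u, C n u -> `|u| <= B ->
      - d <= ip p (u - p)].
Proof.
move=> Ccl Cconv Cdec Cq.
pose N n := [set `|u| ^+ 2 | u in C n].
pose m n := inf (N n).
have N_inf n : has_inf (N n).
  by split; [exists (`|q| ^+ 2), q | exists 0 => _ [u _ <-]].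
have m_le n u : C n u -> m n <= `|u| ^+ 2.
  by move=> Cu; apply: ge_inf; [have [] := N_inf n | exists u].
pose D := sup (range m).
have D_sup : has_sup (range m).
  by split; [exists (m 0%N), 0%N | exists (`|q| ^+ 2) => _ [n _ <-]; exact: m_le].
have m_D n : m n <= D by apply: (sup_upper_bound D_sup); exists n.
have m_mono n k : (n <= k)%N -> m n <= m k.
  move=> nk; apply: lb_le_inf; first by exists (`|q| ^+ 2), q.
  by move=> _ [u Cu <-]; apply: m_le; exact: Cdec Cu.
pose r n : R := n.+1%:R^-1.
have r0 n : 0 < r n by rewrite invr_gt0.
have /choice[p pP] n : exists u, C n u /\ `|u| ^+ 2 < m n + r n.
  by have [_ [u Cu <-] lt_u] := inf_adherent (r0 n) (N_inf n); exists u.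
have pC n k : (n <= k)%N -> C n (p k) by move=> nk; apply: (Cdec _ _ nk); case: (pP k).
have r_le n k : (n <= k)%N -> r k <= r n.
  by move=> nk; rewrite /r lef_pV2 ?posrE // ler_nat.
have rank (e : R) : 0 < e -> exists n, D - e < m n /\ r n < e.
  move=> e0; have [_ [i _ <-] Di] := sup_adherent e0 D_sup.
  have [j] := ltr_add_invr e0; rewrite add0r => je.
  exists (maxn i j); split; first by apply: lt_le_trans Di (m_mono _ _ (leq_maxl _ _)).
  by apply: le_lt_trans je; apply: r_le; exact: leq_maxr.
clearbody r.
(* Cauchy by the parallelogram identity: the midpoint of [p n] and [p k] lies in
   [C n], so its square norm is at least [m n]. *)
have p_cvg : cvg (p n @[n --> \oo]).
  apply: cauchy_cvg; apply: cauchy_exP => e e0.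
  have e20 : 0 < e ^+ 2 / 8 by rewrite divr_gt0 // exprn_gt0.
  have [n [Dn ne]] := rank _ e20.
  exists (p n); exists n => // k /= nk; rewrite -ball_normE /=.
  rewrite -(@ltr_pXn2r _ 2) ?nnegrE //; last exact: ltW.
  have := m_le n (p n + 2^-1 *: (p k - p n)).
  move=> /(_ (Cconv _ _ _ _ (pC _ _ (leqnn n)) (pC _ _ nk) _)).
  have half : 0 <= (2^-1 : R) <= 1 by lra.
  move=> /(_ half).
  have [_ pn] := pP n; have [_ pk] := pP k.
  have := r_le _ _ nk; have := m_D k.
  rewrite sqr_normB.
  move: pn pk; rewrite !ip_norm !(ipDl, ipDr, ipNl, ipNr, ipZl, ipZr) (ipC (p k) (p n)).
  by lra.
pose l := lim (p n @[n --> \oo]); have pl : p n @[n --> \oo] --> l := p_cvg.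
have lC n : C n l.
  by apply: (closed_cvg (C n)) pl => //; exists n => // k /= nk; exact: pC.
have l_D : `|l| ^+ 2 <= D.
  have sq_cvg : ip (p n) (p n) @[n --> \oo] --> ip l l by exact: cvg_ip.
  rewrite ip_norm; apply/ler_addgt0Pr => e e0.
  apply: (cvgr_to_le sq_cvg).
  have [n [_ ne]] := rank _ e0; exists n => // k /= nk.
  have [_] := pP k; rewrite ip_norm; have := r_le _ _ nk; have := m_D k; lra.
exists l; split=> // [z Cz|B d d0].
  rewrite -(@ler_pXn2r _ 2) ?nnegrE //; apply: le_trans l_D _.
  by apply: ge_sup; [exists (m 0%N), 0%N | move=> _ [n _ <-]; exact: m_le].
(* The point [l + s *: (u - l)] of [C n] has square norm at least [m n]; the step
   [s] balances the first and second order terms in [s]. *)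
pose W := (`|B| + `|l|) ^+ 2 + d.
have W0 : 0 < W by rewrite ltr_wpDl // sqr_ge0.
pose s := d / W.
have s0 : 0 < s by rewrite divr_gt0.
have s1 : 0 <= s <= 1.
  by rewrite ltW //= ler_pdivrMr // mul1r lerDr sqr_ge0.
have ds0 : 0 < d * s by rewrite mulr_gt0.
have [n [Dn _]] := rank _ ds0; exists n => u Cu uB.
have := m_le n _ (Cconv _ _ _ _ (lC n) Cu s1).
rewrite sqr_normD ipZr normrZ (gtr0_norm s0) exprMn.
have uW : `|u - l| ^+ 2 <= W.
  have : `|u - l| ^+ 2 <= (`|B| + `|l|) ^+ 2.
    rewrite ler_pXn2r ?nnegrE ?addr_ge0 //.
    by apply: le_trans (ler_normB _ _) _; rewrite lerD2r (le_trans uB) // ler_norm.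
  by rewrite /W; lra.
have sW : s ^+ 2 * `|u - l| ^+ 2 <= s * d.
  rewrite expr2 -mulrA; apply: ler_wpM2l; first exact: ltW.
  by rewrite /s mulrAC ler_pdivrMr // ler_wpM2l // ltW.
move=> mn; rewrite -(ler_pM2l s0).
by lra.
Qed.

(** Minty's lemma: a solution of the dual variational inequality is a zero. *)
Lemma minty (M : H -> H) (u : H) : continuous M ->
  (forall z, 0 <= ip (M z) (z - u)) -> M u = 0.
Proof.
move=> Mc Mz; apply/eqP; rewrite -normr_le0 -(@ler_pXn2r _ 2) ?nnegrE // expr0n /= ip_norm.
have uE : u - (0 : R) *: M u = u by rewrite scale0r subr0.
(* Test the inequality at [z = u - s *: M u] and let [s] decrease to [0]. *)
have lim : ip (M (u - s *: M u)) (M u) @[s --> (0 : R)^'+] --> ip (M u) (M u).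
  apply: cvg_ip => //; last exact: cvg_cst.
  apply: cvg_at_right_filter.
  have shift : u - s *: M u @[s --> (0 : R)] --> u.
    rewrite -[X in _ --> X]uE; apply: cvgB; first exact: cvg_cst.
    by apply: cvgZr_tmp; exact: cvg_id.
  exact: cvg_comp shift (Mc u).
apply: (cvgr_to_le lim); near=> s.
have s0 : 0 < s by [].
have := Mz (u - s *: M u); rewrite addrAC subrr add0r ipNr ipZr oppr_ge0.
by rewrite pmulr_rle0.
Unshelve. all: by end_near. Qed.

(** The variational inequality makes [p] the unique point of least norm, hence
    the value of the projection. *)
Lemma metric_projection_eq (C : set H) (p : H) : C p ->
  (forall z, C z -> `|p| <= `|z|) -> (forall z, C z -> 0 <= ip p (z - p)) ->
  metric_projection C 0 = p.
Proof.
move=> Cp pmin pvar; rewrite /metric_projection.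
set S := (X in get X).
have : S (get S).
  by apply: (@getI _ S p); split=> // z Cz; rewrite !sub0r !normrN; exact: pmin.
move: (get S) => z [Cz /(_ _ Cp)]; rewrite !sub0r !normrN => zp.
apply/eqP; rewrite -subr_eq0 -normr_le0 -(@ler_pXn2r _ 2) ?nnegrE // expr0n /=.
have : `|z| ^+ 2 <= `|p| ^+ 2 by rewrite ler_pXn2r ?nnegrE.
have := pvar z Cz; rewrite sqr_normB ipDr ipNr (ipC z p) -ip_norm; lra.
Qed.

(** The projection of [0] onto [Zer M] is a zero [p] of [M], and [<p, u - p>] is
    nearly nonnegative at the points [u] of the ball of radius [B] where [M] is
    small. *)
Lemma min_norm_zero (M : H -> H) (B : R) : monotone_operator ip M ->
  continuous M -> Zer M !=set0 -> 0 <= B ->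
  let p := metric_projection (Zer M) 0 in
  M p = 0 /\ forall d : R, 0 < d -> exists2 e : R, 0 < e & forall u,
    `|u| <= B -> `|M u| <= e -> - d <= ip p (u - p).
Proof.
move=> Mmon Mc [q Mq] B0 /=.
pose r n : R := n.+1%:R^-1.
have r0 n : 0 < r n by rewrite invr_gt0.
have r_le n k : (n <= k)%N -> r k <= r n.
  by move=> nk; rewrite /r lef_pV2 ?posrE // ler_nat.
have r_small (e : R) : 0 < e -> exists k, r k < e.
  by move=> e0; have [k] := ltr_add_invr e0; rewrite add0r; exists k.
clearbody r.
(* The dual variational inequalities, relaxed by [r n]: closed convex sets that
   intersect in [Zer M], and [C n] contains the points of norm at most [B] where
   the norm of [M] is at most [r n]. *)
pose C n := [set u : H | forall z, - (r n * (B + `|z|)) <= ip (M z) (z - u)].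
have zerC z u : M u = 0 -> 0 <= ip (M z) (z - u).
  by move=> Mu; have := Mmon z u; rewrite Mu subr0.
have Bz0 (z : H) : 0 <= B + `|z| by rewrite addr_ge0.
have [||||p [Cp pmin pvar]] := @nested_convex_min_norm C q.
- move=> n; have -> : C n = \bigcap_(z in setT)
      ((fun u => ip (M z) (z - u)) @^-1` [set y | - (r n * (B + `|z|)) <= y]).
    by apply/seteqP; split=> u /= Cu z; [move=> _; exact: Cu | exact: Cu z I].
  apply: closed_bigI => z _; apply: preimage_closed; last exact: closed_ge.
  move=> u _; apply: cvg_ip => //; first exact: cvg_cst.
  by apply: cvgB; [exact: cvg_cst | exact: cvg_id].
- move=> n u v s Cu Cv /andP[s0 s1] z.
  have -> : ip (M z) (z - (u + s *: (v - u))) =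
      (1 - s) * ip (M z) (z - u) + s * ip (M z) (z - v).
    by rewrite !(ipDr, ipNr, ipZr); ring.
  have /(ler_wpM2l s0) := Cv z.
  have s'0 : 0 <= 1 - s by rewrite subr_ge0.
  have /(ler_wpM2l s'0) := Cu z.
  by lra.
- move=> n k nk u Cu z; apply: le_trans (Cu z).
  by rewrite lerN2 ler_wpM2r // r_le.
- by move=> n z; apply: le_trans (zerC z q Mq); rewrite oppr_le0 mulr_ge0 // ltW.
have Mp : M p = 0.
  apply: minty => // z; apply/ler_addgt0Pr => e e0.
  have e'0 : 0 < e / (B + `|z| + 1) by rewrite divr_gt0 // ltr_wpDl.
  have [k] := r_small _ e'0; rewrite ltr_pdivlMr ?ltr_wpDl // => ke.
  have := Cp k z; have := r0 k.
  by nra.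
have zer_all z : M z = 0 -> forall n, C n z.
  by move=> Mz n w; apply: le_trans (zerC w z Mz); rewrite oppr_le0 mulr_ge0 // ltW.
have pvar0 z : M z = 0 -> 0 <= ip p (z - p).
  move=> Mz; apply/ler_addgt0Pr => e e0.
  have [n /(_ z (zer_all z Mz n) (lexx _))] := pvar `|z| e e0; lra.
have -> : metric_projection (Zer M) 0 = p.
  by apply: metric_projection_eq => // z Mz; exact/pmin/zer_all.
split=> // d d0; have [n pn] := pvar B d d0.
exists (r n) => // u uB Mu; apply: pn => // z.
have := Mmon z u; rewrite ipDl ipNl.
have := ler_norm_ip ip_norm (M u) (z - u).
rewrite ler_norml => /andP[lo _].
have : `|M u| * `|z - u| <= r n * (B + `|z|).
  apply: ler_pM => //; apply: le_trans (ler_normB _ _) _.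
  by rewrite addrC lerD2r.
by lra.
Qed.

End MinimumNorm.

(** * The trajectory *)

Lemma is_derive_shift {R : realType} {V : normedModType R} (f : R -> V)
    (t h : R) (df : V) :
  is_derive (t + h) 1 f df -> is_derive t 1 (fun s => f (s + h)) df.
Proof.
move=> /is_deriveP fdf; apply/is_deriveP => e /fdf[d d0 near_t]; exists d => // s std.
have shift : s + h - (t + h) = s - t by ring.
by have := near_t (s + h); rewrite shift => /(_ std).
Qed.

Lemma cvg_difference_quotient {R : realType} {V : normedModType R} (f : R -> V)
    (t : R) (df : V) :
  is_derive t 1 f df -> h^-1 *: (f (t + h) - f t) @[h --> (0 : R)^'+] --> df.
Proof.
move=> /is_deriveP fdf; apply/cvgrPdist_le => e /fdf[d d0 near_t].
near=> h.
have h0 : 0 < h by [].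
have hd : h < d by near: h; exact: nbhs_right_lt.
have := near_t (t + h); rewrite addrAC subrr add0r (gtr0_norm h0) => /(_ hd) bound.
rewrite -(ler_pM2r h0) [leLHS]mulrC -[X in X * `| _ |](gtr0_norm h0) -normrZ.
by rewrite scalerBr scalerA divff ?gt_eqF // scale1r distrC.
Unshelve. all: by end_near. Qed.

(** The velocity prescribed by the equation [x' = - M x - eps x] along [x]. *)
Definition velocity {R : realType} {H : completeNormedModType R} (M : H -> H)
    (eps : R -> R) (x : R -> H) (t : R) : H := - (M (x t) + eps t *: x t).

Section Trajectory.
Context {R : realType} {H : completeNormedModType R} {ip : {dot H for idfun}}.
Hypothesis ip_norm : inner_product_of_norm ip.
Variables (M : H -> H) (x : R -> H) (eps deps E : R -> R) (a : R).
Hypothesis Mmon : monotone_operator ip M.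

Local Notation v := (velocity M eps x).

Hypothesis eps_gt0 : forall t, a <= t -> 0 < eps t.
Hypothesis eps_deps : forall t, a <= t -> is_derive t 1 eps (deps t).
Hypothesis E_eps : forall t, a <= t -> is_derive t 1 E (eps t).
Hypothesis E_infty : E t @[t --> +oo] --> +oo.
Hypothesis x_v : forall t, a <= t -> is_derive t 1 x (v t).

Let E2_eps t : a <= t -> is_derive t 1 (fun s => 2 * E s) (2 * eps t).
Proof. by move=> /E_eps Et; apply: is_derive_eq. Qed.

(** The damping factor in the Gronwall estimates tends to [0]. *)
Lemma gap_vanishes (F : R -> R) (s C : R) : F t @[t --> +oo] --> +oo ->
  expR (F s - F t) * C @[t --> +oo] --> 0.
Proof.
move=> F_infty.
have -> : (fun t => expR (F s - F t) * C) = (fun t => (expR (F s) * C) * expR (- F t)).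
  by apply/funext => t; rewrite expRD; ring.
rewrite -[X in _ --> X](mulr0 (expR (F s) * C)).
apply: cvgMl_tmp.
exact: (cvg_comp F (fun y => expR (- y)) F_infty (@cvgr_expR R)).
Qed.

Let dist_derive (xi : H) t : a <= t ->
  is_derive t 1 (fun s => ip (x s - xi) (x s - xi)) (2 * ip (v t) (x t - xi)).
Proof. by move=> /x_v; exact: is_derive_ip. Qed.

(** The left-hand side is the derivative of the square distance to a zero [xi]
    of [M]. *)
Lemma dist_zero_ineq (xi : H) t : M xi = 0 ->
  2 * ip (v t) (x t - xi) <=
  - (2 * eps t) * (ip (x t - xi) (x t - xi)) - 2 * (eps t * ip xi (x t - xi)).
Proof.
move=> Mxi; have := Mmon (x t) xi; rewrite Mxi subr0.
rewrite /velocity !(ipNl, ipDl, ipZl); lra.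
Qed.

Lemma trajectory_bounded (xi : H) : M xi = 0 ->
  exists2 B, 0 <= B & forall t, a <= t -> `|x t| <= B.
Proof.
move=> Mxi.
pose u t := ip (x t - xi) (x t - xi).
have bound t : a <= t -> u t <= u a + `|xi| ^+ 2.
  move=> at_.
  have ineq s : a <= s -> 2 * ip (v s) (x s - xi) <= - eps s * (u s - `|xi| ^+ 2).
    move=> as_; apply: le_trans (dist_zero_ineq _ Mxi) _.
    have := ip_ge0 ip_norm (xi + (x s - xi)).
    rewrite [X in _ <= X -> _]ipDl !ipDr (ipC (x s - xi) xi) -/(u s) ip_norm => sq.
    have := eps_gt0 as_; nra.
  have := @gronwall _ u _ E eps (`|xi| ^+ 2) a (dist_derive xi) E_eps ineq a t (lexx a) at_.
  have E_le : E a <= E t.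
    by apply: (nondecreasing_of_derive E_eps) => // s /eps_gt0/ltW.
  have exp1 : expR (E a - E t) <= 1 by rewrite -expR0 ler_expR subr_le0.
  have exp0 := expR_gt0 (E a - E t).
  have ua0 : 0 <= u a by exact: ip_ge0.
  have xi0 : 0 <= `|xi| ^+ 2 by exact: sqr_ge0.
  by nra.
exists (u a + `|xi| ^+ 2 + 1 + `|xi|) => [|t /bound ut].
  by rewrite !addr_ge0 ?sqr_ge0 //; exact: ip_ge0.
rewrite -[x t](subrK xi); apply: le_trans (ler_normD _ _) _; rewrite lerD2r.
have := normr_ge0 (x t - xi); have := sqr_ge0 (`|x t - xi| - 1); move: ut; rewrite /u -ip_norm; lra.
Qed.

(** The difference quotient [h^-1 *: (x (t + h) - x t)] of the trajectory: its
    square norm satisfies a differential inequality from which the increments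
    of [M] have disappeared, by monotonicity. *)
Let D h t := h^-1 *: (x (t + h) - x t).

Let Dsq h t := `|D h t| ^+ 2.

Let q h t := h^-1 * (eps (t + h) - eps t).

Let Dsq_derive h t : 0 < h -> a <= t ->
  is_derive t 1 (Dsq h) (2 * ip (h^-1 *: (v (t + h) - v t)) (D h t)).
Proof.
move=> h0 at_.
have xt := x_v at_.
have xth : is_derive t 1 (fun s => x (s + h)) (v (t + h)).
  by apply: is_derive_shift; apply: x_v; rewrite (le_trans at_) // lerDl ltW.
have Dt : is_derive t 1 (D h) (h^-1 *: (v (t + h) - v t)).
  exact: is_derive_eq.
have := is_derive_ip ip_norm 0 Dt.
rewrite subr0; have -> // : (fun s => ip (D h s - 0) (D h s - 0)) = Dsq h.
by apply/funext => s; rewrite subr0 /Dsq ip_norm.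
Qed.

Let Dsq_ineq h t : 0 < h ->
  2 * ip (h^-1 *: (v (t + h) - v t)) (D h t) <=
  - (2 * eps (t + h)) * Dsq h t - 2 * (q h t * ip (x t) (D h t)).
Proof.
move=> h0; have hh : h^-1 * h = 1 by rewrite mulVf // gt_eqF.
have h'0 : 0 < h^-1 by rewrite invr_gt0.
have hD : x (t + h) - x t = h *: D h t by rewrite /D scalerA mulfV ?gt_eqF // scale1r.
have := Mmon (x (t + h)) (x t); rewrite hD ipZr pmulr_rge0 //.
have ipx : ip (x (t + h)) (D h t) = h * ip (D h t) (D h t) + ip (x t) (D h t).
  by rewrite -ipZl -hD -ipDl subrK.
rewrite /Dsq /q ip_norm; move: (D h t) ipx => y ipx.
rewrite /velocity !(ipZl, ipDl, ipNl) ipx => mon.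
have /(ler_wpM2l (ltW h'0)) := mon; rewrite mulr0 => mon'.
have -> : h^-1 * (- (ip (M (x (t + h))) y + eps (t + h) * (h * ip y y + ip (x t) y)) -
    - (ip (M (x t)) y + eps t * ip (x t) y)) =
    - (h^-1 * (ip (M (x (t + h))) y - ip (M (x t)) y)) - (h^-1 * h) * (eps (t + h) * ip y y) -
    h^-1 * (eps (t + h) - eps t) * ip (x t) y by ring.
by rewrite hh; lra.
Qed.

Let Dsq_cvg t : a <= t -> Dsq h t @[h --> (0 : R)^'+] --> `|v t| ^+ 2.
Proof.
move=> /x_v/cvg_difference_quotient lim.
rewrite ip_norm; under eq_cvg do rewrite /Dsq ip_norm.
exact: cvg_ip.
Qed.

Let E_shift_cvg t : a <= t -> E (t + h) @[h --> (0 : R)^'+] --> E t.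
Proof.
move=> at_; apply: cvg_at_right_filter.
have Ec : {for t, continuous E}.
  by apply/differentiable_continuous/derivable1_diffP; have [] := E_eps at_.
have shift : t + h @[h --> (0 : R)] --> t.
  by rewrite -[X in _ --> X]addr0; apply: cvgD; [exact: cvg_cst | exact: cvg_id].
exact: cvg_comp shift Ec.
Qed.

Let gap_cvg (k s t : R) : a <= s -> a <= t ->
  expR (k * (E (s + h) - E (t + h))) @[h --> (0 : R)^'+] --> expR (k * (E s - E t)).
Proof.
move=> as_ at_.
have lim : k * (E (s + h) - E (t + h)) @[h --> (0 : R)^'+] --> k * (E s - E t).
  by apply: cvgMl_tmp; apply: cvgB; exact: E_shift_cvg.
exact: cvg_comp lim (@continuous_expR R _).
Qed.

Variable (B : R).
Hypothesis B1 : 1 <= B.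
Hypothesis xB : forall t, a <= t -> `|x t| ^+ 2 <= B.

(** Passing to the limit [h -> 0] in the Gronwall estimate for the difference
    quotient; [V] is a primitive of [|deps|]. *)
Lemma speed_bound_integrable (V : R -> R) (K s t : R) :
  (forall t, a <= t -> is_derive t 1 V `|deps t|) ->
  (forall t, a <= t -> V t <= K) -> a <= s -> s <= t ->
  1 + `|v t| ^+ 2 <=
  expR (B * (K - V s)) * (1 + expR (2 * (E s - E t)) * `|v s| ^+ 2).
Proof.
move=> Vd VK as_ st; have at_ : a <= t by exact: le_trans as_ st.
have V_mono := nondecreasing_of_derive Vd (fun t _ => normr_ge0 (deps t)).
have epsV r r' : a <= r -> r <= r' -> `|eps r' - eps r| <= V r' - V r.
  move=> ar rr'.
  have up : V r - eps r <= V r' - eps r'.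
    apply: (@nondecreasing_of_derive _ (fun t => V t - eps t)
      (fun t => `|deps t| - deps t) a) => // w aw.
      by have := Vd w aw; have := eps_deps aw => ? ?; exact: is_deriveB.
    by rewrite subr_ge0 ler_norm.
  have dn : V r + eps r <= V r' + eps r'.
    apply: (@nondecreasing_of_derive _ (fun t => V t + eps t)
      (fun t => `|deps t| + deps t) a) => // w aw.
      by have := Vd w aw; have := eps_deps aw => ? ?; exact: is_deriveD.
    by have := ler_norm (- deps w); rewrite normrN; lra.
  by rewrite ler_norml; apply/andP; split; lra.
have Vc : {within `[a, +oo[, continuous V}.
  apply: derivable_within_continuous => w; rewrite in_itv /= andbT => aw.
  by have [] := Vd w aw.
have [F FV] := exists_primitive Vc.
have step h : 0 < h -> 1 + Dsq h t <= expR (B * (K - V s)) *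
    (1 + expR (2 * (E (s + h) - E (t + h))) * Dsq h s).
  move=> h0.
  have h'0 : 0 < h^-1 by rewrite invr_gt0.
  (* [Q] takes values between [0] and [K - V s], and its derivative [dQ] dominates
     [q h] in absolute value; the factor [expR (- (B * Q r))] absorbs the term in [q h]. *)
  pose Q r := h^-1 * (F (r + h) - F r) - V s.
  have FVb r : s <= r -> V s <= h^-1 * (F (r + h) - F r) <= K.
    move=> sr; have ar : a <= r by exact: le_trans as_ sr.
    have [|||c] := @MVT_segment _ F V r (r + h); first by rewrite lerDl ltW.
    - move=> w; rewrite in_itv /= => /andP[rw _]; apply: FV.
      exact: le_trans ar (ltW rw).
    - apply: derivable_within_continuous => w; rewrite in_itv /= => /andP[rw _].
      by have [] := FV w (le_trans ar rw).
    rewrite in_itv /= => /andP[rc _] ->; rewrite (addrC r) addrK mulrCA mulVf ?gt_eqF // mulr1.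
    by rewrite VK ?(le_trans ar) // V_mono // (le_trans sr).
  have Q0 r : s <= r -> 0 <= Q r <= K - V s.
    by move=> /FVb/andP[lo hi]; rewrite /Q subr_ge0 lo lerD2r.
  pose dQ r := h^-1 * (V (r + h) - V r).
  have Qd r : a <= r -> is_derive r 1 Q (dQ r).
    move=> ar; have Fr := FV r ar.
    have Frh : is_derive r 1 (fun s => F (s + h)) (V (r + h)).
      by apply: is_derive_shift; apply: FV; rewrite (le_trans ar) // lerDl ltW.
    by apply: is_derive_eq; rewrite subr0.
  pose P r := (1 + Dsq h r) * expR (- (B * Q r)).
  pose dP r := expR (- (B * Q r)) * (2 * ip (h^-1 *: (v (r + h) - v r)) (D h r) -
    B * dQ r * (1 + Dsq h r)).
  have Pd r : s <= r -> is_derive r 1 P (dP r).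
    move=> sr; have ar : a <= r by exact: le_trans as_ sr.
    have Dr := Dsq_derive h0 ar; have Qr := Qd r ar.
    apply: is_derive_eq; rewrite /dP /GRing.scale /=; ring.
  have Eh r : s <= r -> is_derive r 1 (fun w => 2 * E (w + h)) (2 * eps (r + h)).
    move=> sr.
    apply: (@is_derive_shift _ _ (fun w => 2 * E w)); apply: E2_eps.
    by rewrite (le_trans as_) // (le_trans sr) // lerDl ltW.
  have ineq r : s <= r -> dP r <= - (2 * eps (r + h)) * (P r - 1).
    move=> sr; have ar : a <= r by exact: le_trans as_ sr.
    have arh : a <= r + h by rewrite (le_trans ar) // lerDl ltW.
    have exp0 : 0 < expR (- (B * Q r)) by exact: expR_gt0.
    have exp1 : expR (- (B * Q r)) <= 1.
      rewrite -expR0 ler_expR oppr_le0 mulr_ge0 //; first exact: le_trans B1.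
      by case/andP: (Q0 r sr).
    have inner : 2 * ip (h^-1 *: (v (r + h) - v r)) (D h r) -
        B * dQ r * (1 + Dsq h r) <= - (2 * eps (r + h)) * Dsq h r.
      have qdQ : `|q h r| <= dQ r.
        by rewrite /q /dQ normrM (gtr0_norm h'0) ler_wpM2l ?(ltW h'0) // epsV // lerDl ltW.
      have ipB : `|2 * ip (x r) (D h r)| <= B * (1 + Dsq h r).
        have := ip_ge0 ip_norm (x r + D h r); have := ip_ge0 ip_norm (x r - D h r).
        rewrite !(ipDl, ipDr, ipNl, ipNr) (ipC (D h r) (x r)) -!ip_norm -/(Dsq h r).
        have nB : Dsq h r <= B * Dsq h r by rewrite ler_peMl // sqr_ge0.
        have := xB ar; rewrite mulrDr mulr1 => xrB ? ?.
        by rewrite ler_norml; apply/andP; split; lra.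
      have := Dsq_ineq r h0.
      have : `|q h r * (2 * ip (x r) (D h r))| <= dQ r * (B * (1 + Dsq h r)).
        by rewrite normrM ler_pM.
      rewrite ler_norml => /andP[lo _]; lra.
    have := ler_wpM2l (ltW exp0) inner; rewrite -/(dP r) => le1.
    apply: le_trans le1 _; rewrite /P.
    have := eps_gt0 arh; have : 0 <= Dsq h r by exact: sqr_ge0.
    move: (expR _) exp0 exp1 (Dsq h r) (eps _) => w w0 w1 n e n0 e0.
    nra.
  have := gronwall Pd Eh ineq (lexx s) st.
  rewrite -mulrBr.
  have Ps : P s - 1 <= Dsq h s.
    rewrite /P lerBlDl ler_piMr //; first by rewrite addr_ge0 // sqr_ge0.
    rewrite -expR0 ler_expR oppr_le0 mulr_ge0 //; first exact: le_trans B1.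
    by case/andP: (Q0 s (lexx s)).
  have /(ler_wpM2l (expR_ge0 (2 * (E (s + h) - E (t + h))))) := Ps.
  move=> le1 le2; have {le1 le2} := le_trans le2 le1.
  rewrite lerBlDl /P expRN ler_pdivrMr ?expR_gt0 // => /le_trans; apply.
  rewrite mulrC ler_wpM2r //; first by rewrite addr_ge0 // mulr_ge0 ?expR_ge0 // sqr_ge0.
  rewrite ler_expR ler_wpM2l //; first exact: le_trans B1.
  by case/andP: (Q0 t st).
have lim1 : 1 + Dsq h t @[h --> (0 : R)^'+] --> 1 + `|v t| ^+ 2.
  by apply: cvgD; [exact: cvg_cst | exact: Dsq_cvg].
have lim2 : expR (B * (K - V s)) * (1 + expR (2 * (E (s + h) - E (t + h))) * Dsq h s)
    @[h --> (0 : R)^'+] --> expR (B * (K - V s)) * (1 + expR (2 * (E s - E t)) * `|v s| ^+ 2).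
  apply: cvgMl_tmp; apply: cvgD; first exact: cvg_cst.
  by apply: cvgM; [exact: gap_cvg | exact: Dsq_cvg].
apply: (ler_cvg_to lim1 lim2); near=> h; apply: step.
by [].
Unshelve. all: by end_near. Qed.

(** The corresponding limit when [|deps| <= d * eps]: then [eps] varies by a
    factor at most [expR (d * h)] between [r] and [r + h]. *)
Lemma speed_bound_ratio (d s t : R) : 0 < d ->
  (forall r, s <= r -> `|deps r| <= d * eps r) -> a <= s -> s <= t ->
  `|v t| ^+ 2 <= d ^+ 2 * B + expR (E s - E t) * `|v s| ^+ 2.
Proof.
move=> d0 ratio as_ st; have at_ : a <= t by exact: le_trans as_ st.
pose c h := h^-1 * (expR (d * h) - 1).
have c_cvg : c h @[h --> (0 : R)^'+] --> d.
  have expd : is_derive (0 : R) 1 (fun h => expR (d * h)) d.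
    apply: is_derive_eq; rewrite /GRing.scale /= mulr0 expR0 !mulr1 ?mul1r //.
  have := cvg_difference_quotient expd.
  rewrite mulr0 expR0; under eq_cvg do rewrite add0r.
  exact.
have qc h r : 0 < h -> s <= r -> `|q h r| <= c h * eps (r + h).
  move=> h0 sr; have h'0 : 0 < h^-1 by rewrite invr_gt0.
  have rrh : r <= r + h by rewrite lerDl ltW.
  have up : eps r * expR (d * r) <= eps (r + h) * expR (d * (r + h)).
    apply: (@nondecreasing_of_derive _ (fun w => eps w * expR (d * w))
      (fun w => expR (d * w) * (deps w + d * eps w)) s) => // w sw.
      have := eps_deps (le_trans as_ sw) => epsw.
      by apply: is_derive_eq; rewrite /GRing.scale /=; ring.
    rewrite mulr_ge0 ?expR_ge0 //.
    by have := ratio w sw; rewrite ler_norml => /andP[? _]; lra.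
  have dn : eps (r + h) * expR (- (d * (r + h))) <= eps r * expR (- (d * r)).
    apply: (@nonincreasing_of_derive _ (fun w => eps w * expR (- (d * w)))
      (fun w => expR (- (d * w)) * (deps w - d * eps w)) s) => // w sw.
      have := eps_deps (le_trans as_ sw) => epsw.
      by apply: is_derive_eq; rewrite /GRing.scale /=; ring.
    rewrite mulr_ge0_le0 ?expR_ge0 //.
    by have := ratio w sw; rewrite ler_norml => /andP[_ ?]; lra.
  have {}up : eps r <= eps (r + h) * expR (d * h).
    rewrite -(ler_pM2r (expR_gt0 (d * r))) -mulrA -expRD -mulrDr (addrC h).
    exact: up.
  have {}dn : eps (r + h) <= eps r * expR (d * h).
    rewrite -(ler_pM2r (expR_gt0 (- (d * (r + h))))) -mulrA -expRD.
    by have -> : d * h + - (d * (r + h)) = - (d * r) by ring.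
  have eps0 : 0 < eps (r + h) by apply: eps_gt0; rewrite (le_trans as_) // (le_trans sr).
  have epsr0 : 0 < eps r by apply: eps_gt0; rewrite (le_trans as_).
  have exp1 : 1 <= expR (d * h) by rewrite -expR0 ler_expR mulr_ge0 // ltW.
  rewrite /q /c normrM (gtr0_norm h'0) -mulrA ler_wpM2l ?(ltW h'0) //.
  rewrite ler_norml; apply/andP; split; nra.
have step h : 0 < h ->
    Dsq h t <= c h ^+ 2 * B + expR (1 * (E (s + h) - E (t + h))) * Dsq h s.
  move=> h0.
  have ineq r : s <= r -> 2 * ip (h^-1 *: (v (r + h) - v r)) (D h r) <=
      - eps (r + h) * (Dsq h r - c h ^+ 2 * B).
    move=> sr; have ar : a <= r by exact: le_trans as_ sr.
    have e0 : 0 < eps (r + h) by apply: eps_gt0; rewrite (le_trans ar) // lerDl ltW.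
    apply: le_trans (Dsq_ineq r h0) _.
    have ipc (y : H) : 2 * c h * `|ip (x r) y| <= c h ^+ 2 * B + `|y| ^+ 2.
      have := ip_ge0 ip_norm (c h *: x r + y); have := ip_ge0 ip_norm (c h *: x r - y).
      rewrite !(ipDl, ipDr, ipNl, ipNr, ipZl, ipZr) (ipC y (x r)) -!ip_norm.
      have := ler_wpM2l (sqr_ge0 (c h)) (xB ar).
      by case: (ger0P (ip (x r) y)) => ?; lra.
    have : - (q h r * ip (x r) (D h r)) <= c h * eps (r + h) * `|ip (x r) (D h r)|.
      apply: le_trans (ler_norm _) _; rewrite normrN normrM ler_wpM2r //.
      exact: qc.
    have := ler_wpM2l (ltW e0) (ipc (D h r)); rewrite -/(Dsq h r); lra.
  have Eh r : s <= r -> is_derive r 1 (fun w => E (w + h)) (eps (r + h)).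
    move=> sr; apply: is_derive_shift; apply: E_eps.
    by rewrite (le_trans as_) // (le_trans sr) // lerDl ltW.
  have Dd r : s <= r -> is_derive r 1 (Dsq h) (2 * ip (h^-1 *: (v (r + h) - v r)) (D h r)).
    by move=> sr; apply: Dsq_derive => //; exact: le_trans as_ sr.
  have := gronwall Dd Eh ineq (lexx s) st.
  rewrite mul1r.
  have : 0 <= expR (E (s + h) - E (t + h)) * (c h ^+ 2 * B).
    by rewrite mulr_ge0 ?expR_ge0 // mulr_ge0 ?sqr_ge0 // (le_trans _ B1).
  lra.
have lim : c h ^+ 2 * B + expR (1 * (E (s + h) - E (t + h))) * Dsq h s
    @[h --> (0 : R)^'+] --> d ^+ 2 * B + expR (1 * (E s - E t)) * `|v s| ^+ 2.
  apply: cvgD; last by apply: cvgM; [exact: gap_cvg | exact: Dsq_cvg].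
  by apply: cvgMr_tmp; rewrite expr2; under eq_cvg do rewrite expr2; exact: cvgM.
rewrite -[E s - E t]mul1r.
apply: (ler_cvg_to (Dsq_cvg at_) lim); near=> h; apply: step.
by [].
Unshelve. all: by end_near. Qed.

Lemma speed_vanishes_integrable (V : R -> R) (K : R) :
  (forall t, a <= t -> is_derive t 1 V `|deps t|) ->
  (forall t, a <= t -> V t <= K) -> `|v t| @[t --> +oo] --> 0.
Proof.
move=> Vd VK.
pose S := [set V t | t in [set t | a <= t]].
have S_sup : has_sup S.
  by split; [exists (V a), a => //=; exact: lexx | exists K => _ [t /= at_ <-]; exact: VK].
have V_sup t : a <= t -> V t <= sup S.
  by move=> at_; apply: (sup_upper_bound S_sup); exists t.
apply/cvgrPdist_le => e e0.
(* With [y <= 1] and [3 * y <= e ^+ 2], the bound [(1 + y) * (1 + y)] on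
   [1 + `|v t| ^+ 2] gives [`|v t| <= e]. *)
pose y := Num.min 1 (e ^+ 2 / 3).
have y0 : 0 < y by rewrite lt_min ltr01 /= divr_gt0 // exprn_gt0.
have B0 : 0 < B by exact: lt_le_trans B1.
have ln0 : 0 < ln (1 + y) / B by rewrite divr_gt0 // ln_gt0 // ltrDl.
have [_ [s /= as_ <-] Vs] := sup_adherent ln0 S_sup.
have expy : expR (B * (sup S - V s)) <= 1 + y.
  have -> : 1 + y = expR (ln (1 + y)) by rewrite lnK // posrE addr_gt0.
  rewrite ler_expR -ler_pdivlMl // mulrC; lra.
have E2_infty : 2 * E t @[t --> +oo] --> +oo by apply: gt0_cvgMry.
have gap : expR (2 * E s - 2 * E t) * `|v s| ^+ 2 @[t --> +oo] --> 0.
  exact: (gap_vanishes _ _ E2_infty).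
have /cvgrPdist_le/(_ _ y0) near_gap := gap.
near=> t.
have st : s <= t by near: t; apply: nbhs_pinfty_ge; exact: num_real.
have gapt : expR (2 * (E s - E t)) * `|v s| ^+ 2 <= y.
  have : `|0 - expR (2 * E s - 2 * E t) * `|v s| ^+ 2| <= y by near: t; exact: near_gap.
  by rewrite sub0r normrN mulrBr; exact: le_trans (ler_norm _).
rewrite sub0r normrN normr_id -(@ler_pXn2r _ 2) ?nnegrE //; last exact: ltW.
have := speed_bound_integrable Vd V_sup as_ st.
have := expR_gt0 (B * (sup S - V s)).
have : y <= 1 by rewrite ge_min lexx.
have : y <= e ^+ 2 / 3 by rewrite ge_min lexx orbT.
have g0 : 0 <= expR (2 * (E s - E t)) * `|v s| ^+ 2 by rewrite mulr_ge0 ?expR_ge0 // sqr_ge0.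
move: (expR (B * _)) expy (_ * `|v s| ^+ 2) gapt g0 => w wy g gy g0 ye y1 w0 bound.
have : w * (1 + g) <= (1 + y) * (1 + y) by apply: ler_pM => //; lra.
nra.
Unshelve. all: by end_near. Qed.

Lemma speed_vanishes_ratio : `|deps t| / eps t @[t --> +oo] --> 0 ->
  `|v t| @[t --> +oo] --> 0.
Proof.
move=> /cvgrPdist_le ratio; apply/cvgrPdist_le => e e0.
have B0 : 0 < B by exact: lt_le_trans B1.
pose d := e / (2 * B).
have d0 : 0 < d by rewrite divr_gt0 // mulr_gt0.
have [s [as_ ratio_s]] : exists s, a <= s /\ forall r, s <= r -> `|deps r| <= d * eps r.
  have [T [_ near_T]] := ratio d d0.
  exists (Num.max a (T + 1)); split; first by rewrite le_max lexx.
  move=> r; rewrite ge_max => /andP[ar Tr].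
  have Tr' : T < r by lra.
  have eps0 := eps_gt0 ar.
  rewrite -ler_pdivrMr //; apply: le_trans (ler_norm _) _.
  by have := near_T r Tr'; rewrite sub0r normrN.
have e20 : 0 < e ^+ 2 / 2 by rewrite divr_gt0 // exprn_gt0.
have /cvgrPdist_le/(_ _ e20) near_gap := gap_vanishes s (`|v s| ^+ 2) E_infty.
near=> t.
have st : s <= t by near: t; apply: nbhs_pinfty_ge; exact: num_real.
have gapt : expR (E s - E t) * `|v s| ^+ 2 <= e ^+ 2 / 2.
  have : `|0 - expR (E s - E t) * `|v s| ^+ 2| <= e ^+ 2 / 2 by near: t; exact: near_gap.
  by rewrite sub0r normrN; exact: le_trans (ler_norm _).
rewrite sub0r normrN normr_id -(@ler_pXn2r _ 2) ?nnegrE //; last exact: ltW.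
apply: le_trans (speed_bound_ratio d0 ratio_s as_ st) _.
have dB : d * B = e / 2 by rewrite /d invfM mulrA mulfVK // gt_eqF.
have de : d <= e / 2 by rewrite -dB ler_peMr // ltW.
have : d ^+ 2 * B <= e ^+ 2 / 2.
  rewrite expr2 -mulrA dB; have := ler_wpM2r (ltW e0) de; nra.
lra.
Unshelve. all: by end_near. Qed.

Lemma operator_vanishes : eps t @[t --> +oo] --> 0 -> `|v t| @[t --> +oo] --> 0 ->
  `|M (x t)| @[t --> +oo] --> 0.
Proof.
move=> eps0 v0.
have bound : `|v t| + eps t * B @[t --> +oo] --> 0.
  rewrite -[X in _ --> X](addr0 0) -[X in _ --> _ + X](mul0r B).
  by apply: cvgD => //; exact: cvgMr_tmp.
apply: (squeeze_cvgr _ (cvg_cst 0) bound).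
near=> t.
have at_ : a <= t by near: t; apply: nbhs_pinfty_ge; exact: num_real.
rewrite normr_ge0 /=.
have -> : M (x t) = - v t - eps t *: x t by rewrite /velocity opprK addrK.
apply: le_trans (ler_normB _ _) _; rewrite normrN lerD2l normrZ gtr0_norm ?eps_gt0 //.
rewrite ler_wpM2l ?(ltW (eps_gt0 at_)) //.
rewrite -(@ler_pXn2r _ 2) ?nnegrE //; last exact: le_trans B1.
by apply: le_trans (xB at_) _; rewrite expr2 ler_peMl // (le_trans _ B1).
Unshelve. all: by end_near. Qed.

Lemma trajectory_cvg (p : H) : M p = 0 ->
  (forall d : R, 0 < d -> \forall t \near +oo, - d <= ip p (x t - p)) ->
  x t @[t --> +oo] --> p.
Proof.
move=> Mp near_p; apply/cvgrPdist_le => e e0.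
have d0 : 0 < e ^+ 2 / 2 by rewrite divr_gt0 // exprn_gt0.
have [T [_ near_T]] := near_p _ d0.
pose s := Num.max a (T + 1).
have as_ : a <= s by rewrite le_max lexx.
pose u t := ip (x t - p) (x t - p).
have u_derive t : s <= t -> is_derive t 1 u (2 * ip (v t) (x t - p)).
  by move=> st; apply: dist_derive; exact: le_trans as_ st.
have E2s t : s <= t -> is_derive t 1 (fun s => 2 * E s) (2 * eps t).
  by move=> st; apply: E2_eps; exact: le_trans as_ st.
have ineq t : s <= t -> 2 * ip (v t) (x t - p) <= - (2 * eps t) * (u t - e ^+ 2 / 2).
  move=> st; have at_ := le_trans as_ st.
  apply: le_trans (dist_zero_ineq _ Mp) _; rewrite -/(u t).
  have Tt : T < t by move: st; rewrite ge_max => /andP[_]; lra.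
  have := near_T t Tt; have := eps_gt0 at_ => eps0 /(ler_wpM2l (ltW eps0)).
  lra.
have E2_infty : 2 * E t @[t --> +oo] --> +oo by apply: gt0_cvgMry.
have /cvgrPdist_le/(_ _ d0) near_gap := gap_vanishes s (u s) E2_infty.
near=> t.
have st : s <= t by near: t; apply: nbhs_pinfty_ge; exact: num_real.
have gapt : expR (2 * E s - 2 * E t) * u s <= e ^+ 2 / 2.
  have : `|0 - expR (2 * E s - 2 * E t) * u s| <= e ^+ 2 / 2 by near: t; exact: near_gap.
  by rewrite sub0r normrN; exact: le_trans (ler_norm _).
rewrite distrC -(@ler_pXn2r _ 2) ?nnegrE //; last exact: ltW.
rewrite ip_norm -/(u t).
have := gronwall u_derive E2s ineq (lexx s) st.
have : 0 <= expR (2 * E s - 2 * E t) * (e ^+ 2 / 2) by rewrite mulr_ge0 ?expR_ge0 // ltW.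
lra.
Unshelve. all: by end_near. Qed.

End Trajectory.
(** * Convergence of the solution *)

Lemma C1_from_is_derive {R : realType} (t0 t : R) (f df : R -> R) :
  C1_from t0 f df -> t0 < t -> is_derive t 1 f (df t).
Proof.
move=> [fdf _] t0t; apply/is_deriveP => e e0.
have /cvgrPdist_le/(_ _ e0) := fdf t (ltW t0t).
rewrite near_withinE => /nbhs_ballP[d /= d0 near_t].
exists (Num.min d (t - t0)); first by rewrite lt_min d0 subr_gt0.
move=> s; rewrite lt_min => /andP[std stt]; have [->|st] := eqVneq s t.
  by rewrite !subrr scale0r subr0 normr0 mulr0.
have st0 : s - t != 0 by rewrite subr_eq0.
have := near_t s; rewrite -ball_normE /= distrC => /(_ std).
move=> /(_ _)/[!in_itv]/= quot.
have {}quot : `|df t - (f s - f t) / (s - t)| <= e.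
  apply: quot; split; last exact/eqP.
  by move: stt; rewrite andbT ltr_distl => /andP[+ _]; lra.
have -> : f s - f t - (s - t) *: df t = (s - t) * ((f s - f t) / (s - t) - df t).
  by rewrite mulrBr mulrCA mulfV // mulr1.
by rewrite normrM mulrC ler_wpM2r // distrC.
Qed.

Lemma C1_from_continuous {R : realType} (t0 : R) (f df : R -> R) :
  C1_from t0 f df -> {within `[t0, +oo[, continuous f}.
Proof.
move=> [fdf _]; apply/subspace_continuousP => t t0t; apply/cvgrPdist_le => e e0.
have {}t0t : t0 <= t by move: t0t; rewrite /= in_itv /= andbT.
have /cvgrPdist_le/(_ _ ltr01) := fdf t t0t.
rewrite !near_withinE => /nbhs_ballP[d /= d0 near_t].
have L0 : 0 < `|df t| + 1 by rewrite ltr_wpDl.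
apply/nbhs_ballP; exists (Num.min d (e / (`|df t| + 1))) => /=.
  by rewrite lt_min d0 divr_gt0.
move=> s; rewrite -ball_normE /= lt_min ltr_pdivlMr // => /andP[std ste] sA.
have [->|st] := eqVneq s t; first by rewrite subrr normr0 ltW.
have st0 : s - t != 0 by rewrite subr_eq0.
have quot : `|df t - (f s - f t) / (s - t)| <= 1.
  by apply: near_t; [rewrite -ball_normE | split => //; exact/eqP].
have -> : f t - f s = (s - t) * ((df t - (f s - f t) / (s - t)) - df t).
  by rewrite addrAC subrr add0r mulrN mulrCA mulfV // mulr1 opprB.
rewrite normrM distrC; apply: le_trans (ltW ste); rewrite ler_wpM2l //.
by apply: le_trans (ler_normB _ _) _; rewrite addrC lerD2l.
Qed.

(** A strong solution satisfies the equation at every time after [t0]. *)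
Lemma strong_solution_is_derive {R : realType} {H : completeNormedModType R}
    (M : H -> H) (eps : R -> R) (t0 t : R) (x0 : H) (x : R -> H) :
  continuous M -> (forall s, t0 < s -> {for s, continuous eps}) ->
  strong_global_solution M eps t0 x0 x -> t0 < t ->
  is_derive t 1 x (velocity M eps x t).
Proof.
move=> Mc epsc [ac _ ae _] t0t.
apply: (@ae_derive_continuous _ _ t0 t x (velocity M eps x)) => //.
  apply: negligibleS ae => s /= bad good; apply: bad => t0s.
  have [drv eqn] := good t0s; split=> //.
  by apply/eqP; rewrite -addr_eq0 addrA eqn.
have xc : {for t, continuous x}.
  have tt : t0 < t < t + 1 by rewrite t0t ltrDl ltr01.
  by apply: abs_continuous_continuous tt; apply: ac; lra.
apply: cvgN; apply: cvgD; first exact: cvg_comp xc (Mc _).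
by apply: cvgZ; [exact: epsc | exact: xc].
Qed.

Theorem theorem2p7 (R : realType) (H : completeNormedModType R)
    (ip : {dot H for idfun}) (ip_norm : inner_product_of_norm ip)
    (M : H -> H) (M_monotone : monotone_operator ip M)
    (M_continuous : continuous M) (Zer_nonempty : Zer M !=set0)
    (t0 : R) (t0_ge0 : 0 <= t0) (x0 : H)
    (eps deps : R -> R) (eps_gt0 : forall t, t0 <= t -> 0 < eps t)
    (eps_C1 : C1_from t0 eps deps)
    (eps_lim : eps t @[t --> +oo] --> 0)
    (eps_int : (\int[lebesgue_measure]_(t in `[t0, +oo[) (eps t)%:E = +oo)%E)
    (x : R -> H) (x_traj : trajectory_solution M eps t0 x0 x)
    (eps_add :
      (\int[lebesgue_measure]_(t in `[t0, +oo[) `|deps t|%:E < +oo)%E \/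
      `|deps t| / eps t @[t --> +oo] --> 0) :
  `|M (x t)| @[t --> +oo] --> 0 /\
  x t @[t --> +oo] --> metric_projection (Zer M) 0.
Proof.
have eps_drv t (t0t : t0 < t) := C1_from_is_derive eps_C1 t0t.
have eps_cont s : t0 < s -> {for s, continuous eps}.
  move=> t0s; apply/differentiable_continuous/derivable1_diffP.
  by have [] := eps_drv s t0s.
have eps_within := C1_from_continuous eps_C1.
have [E E_eps] := exists_primitive eps_within.
have E_infty : E t @[t --> +oo] --> +oo.
  exact: primitive_unbounded eps_within (fun t t0t => ltW (eps_gt0 t t0t)) E_eps eps_int.
(* At [t0] itself [x] and [eps] need not have two-sided derivatives, so the
   estimates start at a later time. *)
pose a := t0 + 1.
have t0a t : a <= t -> t0 < t by rewrite /a; lra.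
have eps_a t : a <= t -> 0 < eps t by move=> /t0a/ltW; exact: eps_gt0.
have deps_a t : a <= t -> is_derive t 1 eps (deps t) by move=> /t0a; exact: eps_drv.
have E_a t : a <= t -> is_derive t 1 E (eps t) by move=> /t0a/ltW; exact: E_eps.
have x_a t : a <= t -> is_derive t 1 x (velocity M eps x t).
  by move=> /t0a; apply: strong_solution_is_derive (proj1 x_traj).
have [xi Mxi] := Zer_nonempty.
have [B B0 xB] := trajectory_bounded ip_norm M_monotone eps_a E_a x_a Mxi.
pose K := 1 + B ^+ 2.
have K1 : 1 <= K by rewrite lerDl sqr_ge0.
have xK t : a <= t -> `|x t| ^+ 2 <= K.
  move=> at_; apply: le_trans (_ : B ^+ 2 <= _); last by rewrite lerDr.
  by rewrite ler_pXn2r ?nnegrE // xB.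
have speed0 : `|velocity M eps x t| @[t --> +oo] --> 0.
  case: eps_add => [deps_int|ratio]; last first.
    exact: (speed_vanishes_ratio ip_norm M_monotone eps_a deps_a E_a E_infty x_a K1 xK ratio).
  have deps_within : {within `[t0, +oo[, continuous (fun t => `|deps t|)}.
    by move=> t; apply: cvg_norm; exact: (proj2 eps_C1 t).
  have [V V_deps] := exists_primitive deps_within.
  have [L VL] := primitive_bounded deps_within (fun t _ => normr_ge0 (deps t)) V_deps deps_int.
  exact: (speed_vanishes_integrable ip_norm M_monotone eps_a deps_a E_a E_infty x_a K1 xK
    (fun t h => V_deps t (ltW (t0a t h))) (fun t h => VL t (ltW (t0a t h)))).
have M0 := operator_vanishes eps_a K1 xK eps_lim speed0.
split=> //.
have [Mp near_p] := min_norm_zero ip_norm M_monotone M_continuous Zer_nonempty B0.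
apply: (trajectory_cvg ip_norm M_monotone eps_a E_a E_infty x_a Mp) => d /near_p[e e0 near_e].
have /cvgrPdist_le/(_ _ e0) near_M := M0.
near=> t; apply: near_e.
  by apply: xB; near: t; apply: nbhs_pinfty_ge; exact: num_real.
have : `|0 - `|M (x t)| | <= e by near: t; exact: near_M.
by rewrite sub0r normrN normr_id.
Unshelve. all: by end_near. Qed.
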